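(* Let $K$ be a commutative unital ring and $G$ a group. The globalization functor $\Lambda: K_{par}G\text{-}\mathbf{Mod}\to G\text{-}\mathbf{Mod}$, $\Lambda(M)=KG\otimes_{G_{par}}M$, from left $K_{par}G$-modules to left $KG$-modules, is exact.
   Context: $K$ is a fixed commutative unital ring; $\otimes=\otimes_K$; $G$ is a group. $\mathcal S(G)$ is the (inverse) monoid with generators $[t]$, $t\in G$, and relations $[1_G]=1$, $[s^{-1}][s][t]=[s^{-1}][st]$, $[s][t][t^{-1}]=[st][t^{-1}]$. $K_{par}G$ is the semigroup $K$-algebra of $\mathcal S(G)$; $e_g:=[g][g^{-1}]$ are commuting idempotents. For a left $K_{par}G$-module $M$, $\Lambda(M)=KG\otimes_{G_{par}}M$ is the quotient of $KG\otimes M$ by the $K$-submodule generated by all $gh\otimes e_{h^{-1}}\cdot m-g\otimes[h]\cdot m$ ($g,h\in G$, $m\in M$), with left $G$-action $h\cdot(g\otimes_{G_{par}}m)=hg\otimes_{G_{par}}m$. On a morphism $f:M\to N$ of $K_{par}G$-modules, $\Lambda(f)(g\otimes_{G_{par}}m)=g\otimes_{G_{par}}f(m)$. *)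

(* Defs.v *)
From HB Require Import structures.
From mathcomp Require Import all_boot all_algebra.
From mathcomp Require Import finmap.
From mathcomp Require Import boolp.
From mathcomp Require Import monalg.

Set Implicit Arguments.
Unset Strict Implicit.
Unset Printing Implicit Defensive.

Import GRing.Theory.
Local Open Scope ring_scope.
Local Open Scope quotient_scope.

(** [malg] has a linear structure only over nontrivial rings, whereas here the
    ring of scalars may be the zero ring; hence the copy [freemod].
    The basic operations are locked: otherwise failing unification problems
    unfold them down to finitely supported functions and quotients. *)

Definition freemod (K : pzRingType) (X : choiceType) : Type := {malg K[X]}.

HB.instance Definition _ (K : pzRingType) (X : choiceType) :=
  GRing.Zmodule.copy (freemod K X) {malg K[X]}.

HB.lock Definition freemod_scale (K : pzRingType) (X : choiceType)
    (c : K) (u : freemod K X) : freemod K X :=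
  [malg x in msupp u => c * u@_x].

HB.lock Definition basis (K : pzRingType) (X : choiceType) (x : X) :
    freemod K X :=
  << 1 *g x >>.
Arguments basis K {X} x.

HB.lock Definition freemod_lift (K : pzRingType) (X : choiceType)
    (V : lmodType K) (f : X -> V) (u : freemod K X) : V :=
  \sum_(x <- msupp u) u@_x *: f x.

Section FreeModule.
Variables (K : pzRingType) (X : choiceType).

Implicit Types (u v : freemod K X) (x : X) (c d : K).

Lemma mcoeff_scale c u x : (freemod_scale c u)@_x = c * u@_x.
Proof. rewrite freemod_scale.unlock; by rewrite mcoeffE; case: msuppP; rewrite ?mulr0. Qed.

Lemma freemod_eq u v : (forall x, u@_x = v@_x) -> u = v.
Proof. by move=> uv; apply/malgP. Qed.

Fact freemod_scaleA c d u :
  freemod_scale c (freemod_scale d u) = freemod_scale (c * d) u.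
Proof. by apply: freemod_eq => x; rewrite !mcoeff_scale mulrA. Qed.

Fact freemod_scale1 : left_id 1 (@freemod_scale K X).
Proof. by move=> u; apply: freemod_eq => x; rewrite mcoeff_scale mul1r. Qed.

Fact freemod_scaleDr : right_distributive (@freemod_scale K X) +%R.
Proof.
move=> c u v; apply: freemod_eq => x.
by rewrite mcoeffD !mcoeff_scale mcoeffD mulrDr.
Qed.

Fact freemod_scaleDl u : {morph (@freemod_scale K X)^~ u : c d / c + d}.
Proof.
by move=> c d; apply: freemod_eq => x; rewrite mcoeffD !mcoeff_scale mulrDl.
Qed.

HB.instance Definition _ := GRing.Zmodule_isLmodule.Build K (freemod K X)
  freemod_scaleA freemod_scale1 freemod_scaleDr freemod_scaleDl.

Lemma mcoeffZ_freemod c u x : (c *: u)@_x = c * u@_x.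
Proof. exact: mcoeff_scale. Qed.

Lemma freemodE u : u = \sum_(x <- msupp u) u@_x *: basis K x.
Proof.
rewrite [LHS](monalgE (u : {malg K[X]})); apply: eq_bigr => x _.
apply: freemod_eq => y.
by rewrite mcoeffZ_freemod basis.unlock !mcoeffU mulrnAr mulr1.
Qed.

Lemma freemod_ind (P : freemod K X -> Prop) :
  P 0 -> (forall c x u, P u -> P (c *: basis K x + u)) -> forall u, P u.
Proof. by move=> P0 PD u; rewrite [u]freemodE; elim/big_rec: _ => // *; apply: PD. Qed.

Section Lift.
Variables (V : lmodType K) (f : X -> V).

Lemma freemod_liftw (D : {fset X}) u : (msupp u `<=` D)%fset ->
  freemod_lift f u = \sum_(x <- D) u@_x *: f x.
Proof.
move=> uD; rewrite freemod_lift.unlock (big_fset_incl _ uD) //= => x _ /mcoeff_outdom.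
by move=> ->; rewrite scale0r.
Qed.

Fact freemod_lift_linear : linear (freemod_lift f).
Proof.
move=> c u v; pose D := (msupp (c *: u + v)%R `|` (msupp u `|` msupp v))%fset.
rewrite !(@freemod_liftw D) /D ?fsubsetUl //; first last.
- by rewrite fsubsetU // fsubsetUl orbT.
- by rewrite fsubsetU // fsubsetUr orbT.
rewrite scaler_sumr -big_split /=; apply: eq_bigr => x _.
by rewrite mcoeffD mcoeffZ_freemod scalerDl scalerA.
Qed.

HB.instance Definition _ := GRing.isLinear.Build K (freemod K X) V *:%R
  (freemod_lift f) freemod_lift_linear.

Lemma freemod_lift_basis x : freemod_lift f (basis K x) = f x.
Proof.
rewrite basis.unlock (@freemod_liftw [fset x]%fset) ?msuppU_le // big_seq_fset1.
by rewrite mcoeffUU scale1r.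
Qed.

End Lift.

Lemma freemod_linear_eq (V : lmodType K) (f g : {linear freemod K X -> V}) :
  (forall x, f (basis K x) = g (basis K x)) -> f =1 g.
Proof.
move=> fg; apply: freemod_ind => [|c x u uP]; first by rewrite !linear0.
by rewrite !linearP fg uP.
Qed.

End FreeModule.

Section Span.
Variables (R : pzRingType) (V : lmodType R) (S : V -> Prop).

Inductive span : V -> Prop :=
| span_zero : span 0
| span_add a v w : S v -> span w -> span (a *: v + w).

Definition spanb : {pred V} := fun v => `[< span v >].

Lemma span_gen v : S v -> span v.
Proof. by move=> Sv; rewrite -[v]addr0 -[v]scale1r; apply/span_add/span_zero. Qed.

Lemma spanD v w : span v -> span w -> span (v + w).
Proof.
move=> vP wP; elim: vP => [|a u v' Su _ IH]; first by rewrite add0r.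
by rewrite -addrA; apply: span_add.
Qed.

Lemma spanZ a v : span v -> span (a *: v).
Proof.
elim=> [|b u w Su _ IH]; first by rewrite scaler0; apply: span_zero.
by rewrite scalerDr scalerA; apply: span_add.
Qed.

Fact spanb_zmod_closed : zmod_closed spanb.
Proof.
split=> [|v w /asboolP vP /asboolP wP]; apply/asboolP; first exact: span_zero.
by apply: spanD => //; rewrite -scaleN1r; apply: spanZ.
Qed.

HB.instance Definition _ := GRing.isZmodClosed.Build V spanb spanb_zmod_closed.

Definition span_zmod : zmodClosed V := GRing.ZmodClosed.clone V spanb _.

Definition quotmod : Type := Quotient.quot span_zmod.

HB.instance Definition _ := GRing.Zmodule.on quotmod.

End Span.

HB.lock Definition qclass (R : pzRingType) (V : lmodType R) (S : V -> Prop)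
    (v : V) : quotmod S :=
  \pi_(Quotient.quot (span_zmod S)) v.

HB.lock Definition quotmod_scale (R : pzRingType) (V : lmodType R)
    (S : V -> Prop) (a : R) (x : quotmod S) : quotmod S :=
  qclass S (a *: repr x).

HB.lock Definition quotmod_lift (R : pzRingType) (V : lmodType R)
    (S : V -> Prop) (W : lmodType R) (f : {linear V -> W})
    (fS : forall v, S v -> f v = 0) (x : quotmod S) : W :=
  f (repr x).

Section QuotientModule.
Variables (R : pzRingType) (V : lmodType R) (S : V -> Prop).

Local Notation qclass := (@qclass R V S).
Local Notation quotmod := (@quotmod R V S).
Local Notation quotmod_scale := (@quotmod_scale R V S).
Local Notation span := (@span R V S).

Lemma repr_qclass (x : quotmod) : qclass (repr x) = x.
Proof. by rewrite qclass.unlock reprK. Qed.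

Lemma qclass_eq v w : qclass v = qclass w <-> span (v - w).
Proof.
rewrite qclass.unlock.
split=> [/eqP|vw]; first by rewrite -Quotient.idealrBE => /asboolP.
by apply/eqP; rewrite -Quotient.idealrBE; apply/asboolP.
Qed.

Lemma qclass_surj (x : quotmod) : exists v, x = qclass v.
Proof. by exists (repr x); rewrite repr_qclass. Qed.

Lemma qclassD v w : qclass (v + w) = qclass v + qclass w.
Proof. by rewrite qclass.unlock; apply: (@Quotient.pi_add V (span_zmod S)). Qed.

Lemma qclassZ a v : qclass (a *: v) = quotmod_scale a (qclass v).
Proof.
rewrite quotmod_scale.unlock; apply/qclass_eq; rewrite -scalerBr.
by apply/spanZ/qclass_eq; rewrite repr_qclass.
Qed.

Fact quotmod_scaleA a b x :
  quotmod_scale a (quotmod_scale b x) = quotmod_scale (a * b) x.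
Proof. by have [v ->] := qclass_surj x; rewrite -!qclassZ scalerA. Qed.

Fact quotmod_scale1 : left_id 1 quotmod_scale.
Proof. by move=> x; have [v ->] := qclass_surj x; rewrite -qclassZ scale1r. Qed.

Fact quotmod_scaleDr : right_distributive quotmod_scale +%R.
Proof.
move=> a x y; have [v ->] := qclass_surj x; have [w ->] := qclass_surj y.
by rewrite -qclassD -!qclassZ scalerDr qclassD.
Qed.

Fact quotmod_scaleDl x : {morph quotmod_scale^~ x : a b / a + b}.
Proof.
by move=> a b; have [v ->] := qclass_surj x; rewrite -!qclassZ scalerDl qclassD.
Qed.

HB.instance Definition _ := GRing.Zmodule_isLmodule.Build R quotmod
  quotmod_scaleA quotmod_scale1 quotmod_scaleDr quotmod_scaleDl.

Fact qclass_linear : linear qclass.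
Proof. by move=> a v w; rewrite qclassD qclassZ. Qed.

HB.instance Definition _ := GRing.isLinear.Build R V quotmod *:%R
  qclass qclass_linear.

Lemma qclass_rel v : S v -> qclass v = 0.
Proof.
by move=> Sv; rewrite -(linear0 qclass); apply/qclass_eq; rewrite subr0; apply: span_gen.
Qed.

Section Lift.
Variables (W : lmodType R) (f : {linear V -> W}).
Hypothesis fS : forall v, S v -> f v = 0.

Lemma span_ker v : span v -> f v = 0.
Proof. by elim=> [|a u w Su _ IH]; rewrite ?linear0 // linearP fS // IH scaler0 addr0. Qed.

Lemma quotmod_liftE v : quotmod_lift fS (qclass v) = f v.
Proof.
rewrite quotmod_lift.unlock.
apply/eqP; rewrite -subr_eq0 -linearB; apply/eqP/span_ker/qclass_eq.
by rewrite repr_qclass.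
Qed.

Fact quotmod_lift_linear : linear (quotmod_lift fS).
Proof.
move=> a x y; have [v ->] := qclass_surj x; have [w ->] := qclass_surj y.
by rewrite -linearP !quotmod_liftE linearP.
Qed.

HB.instance Definition _ := GRing.isLinear.Build R quotmod W *:%R
  (quotmod_lift fS) quotmod_lift_linear.

End Lift.

End QuotientModule.

Section TensorDef.
Variables (K : comPzRingType) (A B : lmodType K).

Local Notation pure a b := (basis K (a, b) : freemod K (A * B)%type).

Inductive tensor_rel : freemod K (A * B)%type -> Prop :=
| tensor_relDl a a' b : tensor_rel (pure (a + a') b - (pure a b + pure a' b))
| tensor_relDr a b b' : tensor_rel (pure a (b + b') - (pure a b + pure a b'))
| tensor_relZl k a b : tensor_rel (pure (k *: a) b - k *: pure a b)
| tensor_relZr k a b : tensor_rel (pure a (k *: b) - k *: pure a b).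

Definition tensor : Type := quotmod tensor_rel.
HB.instance Definition _ := GRing.Lmodule.on tensor.

End TensorDef.

HB.lock Definition tens (K : comPzRingType) (A B : lmodType K) (a : A) (b : B) : tensor A B :=
  qclass (@tensor_rel K A B) (basis K (a, b)).

Section Tensor.
Variables (K : comPzRingType).

Section Theory.
Variables (A B : lmodType K).

Local Notation tensor := (tensor A B).
Local Notation tens := (@tens K A B).
Local Notation tensor_rel := (@tensor_rel K A B).

Lemma tensDl a a' b : tens (a + a') b = tens a b + tens a' b.
Proof.
rewrite tens.unlock -linearD; apply/qclass_eq/span_gen; exact: tensor_relDl.
Qed.

Lemma tensDr a b b' : tens a (b + b') = tens a b + tens a b'.
Proof.
rewrite tens.unlock -linearD; apply/qclass_eq/span_gen; exact: tensor_relDr.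
Qed.

Lemma tensZl k a b : tens (k *: a) b = k *: tens a b.
Proof.
rewrite tens.unlock -linearZ; apply/qclass_eq/span_gen; exact: tensor_relZl.
Qed.

Lemma tensZr k a b : tens a (k *: b) = k *: tens a b.
Proof.
rewrite tens.unlock -linearZ; apply/qclass_eq/span_gen; exact: tensor_relZr.
Qed.

Lemma tens0l b : tens 0 b = 0.
Proof. by have := tensZl 0 0 b; rewrite !scale0r. Qed.

Lemma tensor_ind (P : tensor -> Prop) :
  P 0 -> (forall a b x, P x -> P (tens a b + x)) -> forall x, P x.
Proof.
move=> P0 PD x; have [u ->] := qclass_surj x.
elim/freemod_ind: u => [|c [a b] u uP]; first by rewrite linear0.
by rewrite linearP; have := PD (c *: a) b _ uP; rewrite tensZl tens.unlock.
Qed.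

Section Lift.
Variables (V : lmodType K) (f : A -> B -> V).

Definition bilinear_map : Prop :=
  (forall b, linear (f^~ b)) /\ (forall a, linear (f a)).

Hypothesis f_bil : bilinear_map.

Fact tensor_lift_subproof u : tensor_rel u ->
  freemod_lift (fun p => f p.1 p.2) u = 0.
Proof.
have [fl fr] := f_bil.
have fl0 b : f 0 b = 0.
  by have /eqP := fl b 1 0 0; rewrite !scale1r addr0 -subr_eq subrr eq_sym => /eqP.
have fr0 a : f a 0 = 0.
  by have /eqP := fr a 1 0 0; rewrite !scale1r addr0 -subr_eq subrr eq_sym => /eqP.
case=> [a a' b|a b b'|k a b|k a b];
  apply/eqP; rewrite linearB subr_eq0 ?linearD ?linearZ /=;
  rewrite !freemod_lift_basis /=; apply/eqP.
- by have := fl b 1 a a'; rewrite !scale1r.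
- by have := fr a 1 b b'; rewrite !scale1r.
- by have := fl b k a 0; rewrite fl0 !addr0.
- by have := fr a k b 0; rewrite fr0 !addr0.
Qed.

Definition tensor_lift : tensor -> V := quotmod_lift tensor_lift_subproof.
HB.instance Definition _ := GRing.Linear.on tensor_lift.

Lemma tensor_liftE a b : tensor_lift (tens a b) = f a b.
Proof. by rewrite /tensor_lift tens.unlock quotmod_liftE /= freemod_lift_basis. Qed.

End Lift.
End Theory.

Section Map.
Variables (A A' B B' : lmodType K).
Variables (f : {linear A -> A'}) (g : {linear B -> B'}).

Fact tensor_map_subproof : bilinear_map (fun a b => tens (f a) (g b)).
Proof.
split=> [b|a] k ? ?; rewrite linearP.
- by rewrite tensDl tensZl.
- by rewrite tensDr tensZr.
Qed.

Definition tensor_map : tensor A B -> tensor A' B' :=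
  tensor_lift tensor_map_subproof.
HB.instance Definition _ := GRing.Linear.on tensor_map.

Lemma tensor_mapE a b : tensor_map (tens a b) = tens (f a) (g b).
Proof. exact: tensor_liftE. Qed.

End Map.
End Tensor.

Definition monoidalg (K : comPzRingType) (S : monoidType) : Type := freemod K S.

HB.instance Definition _ (K : comPzRingType) (S : monoidType) :=
  GRing.Lmodule.copy (monoidalg K S) (freemod K S).

Definition mon (K : comPzRingType) (S : monoidType) (s : S) : monoidalg K S :=
  basis K s.
Arguments mon K {S} s.

HB.lock Definition monoidalg_mul (K : comPzRingType) (S : monoidType)
    (u v : monoidalg K S) : monoidalg K S :=
  freemod_lift (fun s => freemod_lift (fun t => mon K (s * t)%g) v) u.

Section MonoidAlgebra.
Variables (K : comPzRingType) (S : monoidType).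

Local Notation mon := (@mon K S).
Local Notation mul := (@monoidalg_mul K S).

Implicit Types (u v w : monoidalg K S).

Lemma monoidalg_ind (P : monoidalg K S -> Prop) :
  P 0 -> (forall c s u, P u -> P (c *: mon s + u)) -> forall u, P u.
Proof. exact: freemod_ind. Qed.


Lemma monoidalg_mulPl c u v w : mul (c *: u + v) w = c *: mul u w + mul v w.
Proof. by rewrite monoidalg_mul.unlock freemod_lift_linear. Qed.

Lemma monoidalg_mul0l w : mul 0 w = 0.
Proof. by rewrite monoidalg_mul.unlock linear0. Qed.

Lemma monoidalg_mulPr c u v w : mul w (c *: u + v) = c *: mul w u + mul w v.
Proof.
elim/monoidalg_ind: w => [|d s w IH].
  by rewrite !monoidalg_mul0l scaler0 addr0.
have basis_mul x : mul (mon s) x = freemod_lift (fun t => mon (s * t)%g) x.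
  by rewrite monoidalg_mul.unlock freemod_lift_basis.
rewrite !monoidalg_mulPl IH !basis_mul freemod_lift_linear !scalerDr.
by rewrite !scalerA [d * c]mulrC addrACA.
Qed.

Lemma monoidalg_mul0r w : mul w 0 = 0.
Proof. by have := monoidalg_mulPr (-1) 0 0 w; rewrite scaler0 addr0 scaleN1r addNr. Qed.

Lemma monM_subproof s t : mul (mon s) (mon t) = mon (s * t)%g.
Proof. by rewrite monoidalg_mul.unlock !freemod_lift_basis. Qed.

Fact monoidalg_mulA : associative mul.
Proof.
have mon3 s t w : mul (mon s) (mul (mon t) w) = mul (mul (mon s) (mon t)) w.
  elim/monoidalg_ind: w => [|c r w IH]; first by rewrite !monoidalg_mul0r.
  by rewrite !monoidalg_mulPr IH !monM_subproof mulgA.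
have mon2 s v w : mul (mon s) (mul v w) = mul (mul (mon s) v) w.
  elim/monoidalg_ind: v => [|c t v IH].
    by rewrite monoidalg_mul0r !monoidalg_mul0l monoidalg_mul0r.
  by rewrite monoidalg_mulPl !monoidalg_mulPr monoidalg_mulPl mon3 IH.
move=> u v w; elim/monoidalg_ind: u => [|c s u IH].
  by rewrite !monoidalg_mul0l.
by rewrite !monoidalg_mulPl mon2 IH.
Qed.

Fact monoidalg_mul1l : left_id (mon 1%g) mul.
Proof.
elim/monoidalg_ind=> [|c s u IH]; first by rewrite monoidalg_mul0r.
by rewrite monoidalg_mulPr IH monM_subproof mul1g.
Qed.

Fact monoidalg_mul1r : right_id (mon 1%g) mul.
Proof.
elim/monoidalg_ind=> [|c s u IH]; first by rewrite monoidalg_mul0l.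
by rewrite monoidalg_mulPl IH monM_subproof mulg1.
Qed.

Fact monoidalg_mulDl : left_distributive mul +%R.
Proof.
by move=> u v w; have := monoidalg_mulPl 1 u v w; rewrite !scale1r.
Qed.

Fact monoidalg_mulDr : right_distributive mul +%R.
Proof.
by move=> w u v; have := monoidalg_mulPr 1 u v w; rewrite !scale1r.
Qed.

HB.instance Definition _ := GRing.Zmodule_isPzRing.Build (monoidalg K S)
  monoidalg_mulA monoidalg_mul1l monoidalg_mul1r
  monoidalg_mulDl monoidalg_mulDr.

Lemma monM s t : mon s * mon t = mon (s * t)%g.
Proof. exact: monM_subproof. Qed.

Lemma mon1 : mon 1%g = 1.
Proof. by []. Qed.

Lemma monoidalg_scaleAl c u v : c *: (u * v) = (c *: u) * v.
Proof. by have := monoidalg_mulPl c u 0 v; rewrite monoidalg_mul0l !addr0. Qed.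

Lemma monoidalg_scaleAr c u v : c *: (u * v) = u * (c *: v).
Proof. by have := monoidalg_mulPr c v 0 u; rewrite monoidalg_mul0r !addr0. Qed.

Definition lmul u : monoidalg K S -> monoidalg K S := fun v => u * v.

Fact lmul_linear u : linear (lmul u).
Proof. by move=> c v w; apply: monoidalg_mulPr. Qed.

HB.instance Definition _ u := GRing.isLinear.Build K (monoidalg K S)
  (monoidalg K S) *:%R (lmul u) (lmul_linear u).

(** [K] acts on a [K[S]]-module through the structure map [c |-> c . 1]. *)
Definition resmod (M : lmodType (monoidalg K S)) : Type := M.

Section Restriction.
Variable M : lmodType (monoidalg K S).

HB.instance Definition _ := GRing.Zmodule.copy (resmod M) M.

Definition resmod_scale (c : K) (m : resmod M) : resmod M :=
  (c *: (1 : monoidalg K S)) *: (m : M).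

Fact resmod_scaleA c d m :
  resmod_scale c (resmod_scale d m) = resmod_scale (c * d) m.
Proof.
by rewrite /resmod_scale scalerA -monoidalg_scaleAl mul1r scalerA.
Qed.

Fact resmod_scale1 : left_id 1 resmod_scale.
Proof. by move=> m; rewrite /resmod_scale !scale1r. Qed.

Fact resmod_scaleDr : right_distributive resmod_scale +%R.
Proof. by move=> c m n; rewrite /resmod_scale scalerDr. Qed.

Fact resmod_scaleDl m : {morph resmod_scale^~ m : c d / c + d}.
Proof. by move=> c d; rewrite /resmod_scale !scalerDl. Qed.

HB.instance Definition _ := GRing.Zmodule_isLmodule.Build K (resmod M)
  resmod_scaleA resmod_scale1 resmod_scaleDr resmod_scaleDl.

End Restriction.

Section RestrictionMap.
Variables (M N : lmodType (monoidalg K S)) (f : {linear M -> N}).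

Definition resmod_map (m : resmod M) : resmod N := f m.

Fact resmod_map_linear : linear resmod_map.
Proof. by move=> c m n; apply: linearP. Qed.

HB.instance Definition _ := GRing.isLinear.Build K (resmod M) (resmod N) *:%R
  resmod_map resmod_map_linear.

End RestrictionMap.
End MonoidAlgebra.

Section Exel.
Variable G : groupType.

(** The congruence on the free monoid [seq G] (the letter [t] stands for the
    generator [[t]]) generated by the defining relations of S(G). *)
Inductive exel_cong : seq G -> seq G -> Prop :=
| exel_refl u : exel_cong u u
| exel_sym u v : exel_cong u v -> exel_cong v u
| exel_trans u v w : exel_cong u v -> exel_cong v w -> exel_cong u w
| exel_cat u u' v v' :
    exel_cong u u' -> exel_cong v v' -> exel_cong (u ++ v) (u' ++ v')
| exel_one : exel_cong [:: 1%g] [::]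
| exel_mulVl s t : exel_cong [:: s^-1%g; s; t] [:: s^-1%g; (s * t)%g]
| exel_mulVr s t : exel_cong [:: s; t; t^-1%g] [:: (s * t)%g; t^-1%g].

Definition exel_congb : rel (seq G) := fun u v => `[< exel_cong u v >].

Fact exel_congb_equiv : equiv_class_of exel_congb.
Proof.
split=> [u|u v|v u w /asboolP uv /asboolP vw]; first exact/asboolP/exel_refl.
- by apply/asbool_equiv_eq; split; apply: exel_sym.
- exact/asboolP/(exel_trans uv vw).
Qed.

Canonical exel_equiv := EquivRelPack exel_congb_equiv.
Canonical exel_encModRel := defaultEncModRel exel_congb.

Definition exel : Type := {eq_quot exel_congb}.
HB.instance Definition _ : EqQuotient _ exel_congb exel := EqQuotient.on exel.
HB.instance Definition _ := Choice.on exel.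

Definition word (u : seq G) : exel := \pi_exel u.

Lemma word_eq u v : word u = word v <-> exel_cong u v.
Proof.
by split=> [/eqP|uv]; [|apply/eqP]; rewrite /word piE; [move/asboolP|apply/asboolP].
Qed.

Lemma word_surj (x : exel) : exists u, x = word u.
Proof. by exists (repr x); rewrite /word reprK. Qed.

Definition exel_mul (x y : exel) : exel := word (repr x ++ repr y).

Lemma exel_mulE u v : exel_mul (word u) (word v) = word (u ++ v).
Proof.
by apply/word_eq/exel_cat; apply/word_eq; rewrite [LHS]/word reprK.
Qed.

Fact exel_mulA : associative exel_mul.
Proof.
move=> x y z; have [u ->] := word_surj x; have [v ->] := word_surj y.
by have [w ->] := word_surj z; rewrite !exel_mulE catA.
Qed.

Fact exel_mul1l : left_id (word [::]) exel_mul.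
Proof. by move=> x; have [u ->] := word_surj x; rewrite exel_mulE. Qed.

Fact exel_mul1r : right_id (word [::]) exel_mul.
Proof. by move=> x; have [u ->] := word_surj x; rewrite exel_mulE cats0. Qed.

HB.instance Definition _ := isMonoid.Build exel
  exel_mulA exel_mul1l exel_mul1r.

Lemma wordM u v : (word u * word v)%g = word (u ++ v).
Proof. exact: exel_mulE. Qed.

Lemma word3 (r s t : G) :
  (word [:: r] * word [:: s] * word [:: t])%g = word [:: r; s; t].
Proof. by rewrite (wordM [:: r] [:: s]) (wordM [:: r; s] [:: t]). Qed.

End Exel.

Notation groupalg K G := (monoidalg K G) (only parsing).
Notation pargroupalg K G := (monoidalg K (exel G)).

Section Generators.
Variables (K : comPzRingType) (G : groupType).

Definition gen (t : G) : pargroupalg K G := mon K (word [:: t]).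

Definition idem (g : G) : pargroupalg K G := gen g * gen g^-1%g.

Lemma gen1 : gen 1%g = 1.
Proof. by congr mon; apply/word_eq/exel_one. Qed.

Lemma gen_mulVl s t : gen s^-1%g * gen s * gen t = gen s^-1%g * gen (s * t)%g.
Proof.
by rewrite /gen !monM; congr mon; rewrite word3 [RHS]wordM; apply/word_eq; exact: exel_mulVl.
Qed.

Lemma gen_mulVr s t : gen s * gen t * gen t^-1%g = gen (s * t)%g * gen t^-1%g.
Proof.
by rewrite /gen !monM; congr mon; rewrite word3 [RHS]wordM; apply/word_eq; exact: exel_mulVr.
Qed.

End Generators.

(** Morphisms are compared pointwise, as linear maps carry their proofs. *)
Record additive_functor (A B : pzRingType) := AdditiveFunctor {
  fobj :> lmodType A -> lmodType B;
  fmap : forall M N : lmodType A, {linear M -> N} -> {linear fobj M -> fobj N};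
  fmap_ext : forall (M N : lmodType A) (f g : {linear M -> N}),
    f =1 g -> fmap f =1 fmap g;
  fmap_id : forall M : lmodType A, fmap (idfun : {linear M -> M}) =1 idfun;
  fmap_comp : forall (M N P : lmodType A)
      (g : {linear N -> P}) (f : {linear M -> N}),
    fmap (g \o f : {linear M -> P}) =1 fmap g \o fmap f;
  fmap_add : forall (M N : lmodType A) (f g : {linear M -> N}),
    fmap (f \+ g : {linear M -> N}) =1 fmap f \+ fmap g
}.

Definition short_exact (A : pzRingType) (M N P : lmodType A)
    (f : {linear M -> N}) (g : {linear N -> P}) : Prop :=
  [/\ injective f,
      forall n, g n = 0 <-> exists m, f m = n
    & forall p, exists n, g n = p].

Definition exact_functor (A B : pzRingType) (F : additive_functor A B) : Prop :=
  forall (M N P : lmodType A) (f : {linear M -> N}) (g : {linear N -> P}),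
    short_exact f g -> short_exact (fmap F f) (fmap F g).

Section Globalization.
Variables (K : comPzRingType) (G : groupType).

Local Notation KG := (groupalg K G).
Local Notation KparG := (pargroupalg K G).

Section Object.
Variable M : lmodType KparG.

Local Notation KGM := (tensor (monoidalg K G) (resmod M)).

Inductive glob_rel : KGM -> Prop :=
| GlobRel (g h : G) (m : M) :
    glob_rel (tens (mon K (g * h)%g) (idem K h^-1%g *: m : resmod M)
              - tens (mon K g) (gen K h *: m : resmod M)).

Definition glob : Type := quotmod glob_rel.
HB.instance Definition _ := GRing.Zmodule.on glob.

Definition gtens (a : KG) (m : M) : glob :=
  qclass glob_rel (tens a (m : resmod M)).

Fact glob_act_subproof (a : KG) x : glob_rel x ->
  (qclass glob_rel \o tensor_map (lmul a) idfun) x = 0.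
Proof.
case=> g h m /=; rewrite linearB /= !tensor_mapE /= /lmul.
elim/monoidalg_ind: a => [|c s a IH].
  by rewrite !mul0r !tens0l subrr linear0.
rewrite 2!mulrDl -2!monoidalg_scaleAl 2!monM mulgA 2!tensDl 2!tensZl.
rewrite opprD addrACA -scalerBr linearD linearZ /= IH.
by rewrite qclass_rel ?scaler0 ?addr0.
Qed.

Definition glob_act (a : KG) (x : glob) : glob :=
  quotmod_lift (glob_act_subproof a) x.

Lemma glob_actE a b m : glob_act a (gtens b m) = gtens (a * b) m.
Proof. by rewrite /glob_act quotmod_liftE /= tensor_mapE. Qed.

Fact glob_actDr : right_distributive glob_act +%R.
Proof. by move=> a x y; apply: linearD. Qed.

Lemma glob_act0 a : glob_act a 0 = 0.
Proof. exact: linear0. Qed.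

Lemma glob_ind (P : glob -> Prop) :
  P 0 -> (forall a m x, P x -> P (gtens a m + x)) -> forall x, P x.
Proof.
move=> P0 PD x; have [t ->] := qclass_surj x.
elim/tensor_ind: t => [|a m t IH]; first by rewrite linear0.
by rewrite linearD; apply: PD.
Qed.

Lemma gtensDl a b m : gtens (a + b) m = gtens a m + gtens b m.
Proof. by rewrite /gtens tensDl linearD. Qed.

Fact glob_actA a b x : glob_act a (glob_act b x) = glob_act (a * b) x.
Proof.
elim/glob_ind: x => [|c m x IH]; first by rewrite !glob_act0.
by rewrite !glob_actDr !glob_actE IH mulrA.
Qed.

Fact glob_act1 : left_id 1 glob_act.
Proof.
elim/glob_ind=> [|c m x IH]; first by rewrite glob_act0.
by rewrite glob_actDr glob_actE IH mul1r.
Qed.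

Fact glob_actDl x : {morph glob_act^~ x : a b / a + b}.
Proof.
move=> a b; elim/glob_ind: x => [|c m x IH]; first by rewrite !glob_act0 addr0.
by rewrite !glob_actDr !glob_actE IH mulrDl gtensDl addrACA.
Qed.

HB.instance Definition _ := GRing.Zmodule_isLmodule.Build KG glob
  glob_actA glob_act1 glob_actDr glob_actDl.

Lemma glob_groupE (h g : G) (m : M) :
  (mon K h : KG) *: gtens (mon K g) m = gtens (mon K (h * g)%g) m.
Proof. by rewrite [LHS]glob_actE monM. Qed.

End Object.

Section Morphism.
Variables (M N : lmodType KparG) (f : {linear M -> N}).

Fact glob_map_subproof x : glob_rel x ->
  (qclass (@glob_rel N) \o tensor_map idfun (resmod_map f)) x = 0.
Proof.
case=> g h m /=; rewrite linearB /= !tensor_mapE /= /resmod_map !linearZ /=.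
exact: qclass_rel.
Qed.

Definition glob_map : glob M -> glob N := quotmod_lift glob_map_subproof.

Lemma glob_mapE a m : glob_map (gtens a m) = gtens a (f m).
Proof. by rewrite /glob_map quotmod_liftE /= tensor_mapE. Qed.

Lemma glob_mapD x y : glob_map (x + y) = glob_map x + glob_map y.
Proof. exact: (linearD (quotmod_lift glob_map_subproof)). Qed.

Lemma glob_map0 : glob_map 0 = 0.
Proof. exact: (linear0 (quotmod_lift glob_map_subproof)). Qed.

Fact glob_map_linear : linear glob_map.
Proof.
move=> a x y; rewrite glob_mapD; congr (_ + _).
elim/glob_ind: x => [|b m x IH]; first by rewrite glob_map0 !scaler0 glob_map0.
rewrite scalerDr !glob_mapD scalerDr IH glob_mapE; congr (_ + _).
by rewrite [_ *: _]glob_actE glob_mapE [RHS]glob_actE.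
Qed.

HB.instance Definition _ := GRing.isLinear.Build KG (glob M) (glob N) *:%R
  glob_map glob_map_linear.

End Morphism.

Fact glob_map_ext (M N : lmodType KparG) (f g : {linear M -> N}) :
  f =1 g -> glob_map f =1 glob_map g.
Proof.
move=> fg x; elim/glob_ind: x => [|a m x IH]; first by rewrite !glob_map0.
by rewrite !glob_mapD !glob_mapE fg IH.
Qed.

Fact glob_map_id (M : lmodType KparG) :
  glob_map (idfun : {linear M -> M}) =1 idfun.
Proof.
move=> x; elim/glob_ind: x => [|a m x IH]; first by rewrite !glob_map0.
by rewrite !glob_mapD !glob_mapE IH.
Qed.

Fact glob_map_comp (M N P : lmodType KparG)
    (g : {linear N -> P}) (f : {linear M -> N}) :
  glob_map (g \o f : {linear M -> P}) =1 glob_map g \o glob_map f.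
Proof.
move=> x; elim/glob_ind: x => [|a m x IH] /=; first by rewrite !glob_map0.
by rewrite !glob_mapD !glob_mapE IH.
Qed.

Fact glob_map_add (M N : lmodType KparG) (f g : {linear M -> N}) :
  glob_map (f \+ g : {linear M -> N}) =1 glob_map f \+ glob_map g.
Proof.
move=> x; elim/glob_ind: x => [|a m x IH] /=; first by rewrite !glob_map0 addr0.
by rewrite !glob_mapD !glob_mapE IH /= /gtens tensDr linearD addrACA.
Qed.

Definition globalization : additive_functor KparG KG :=
  @AdditiveFunctor KparG KG
    (fun M : lmodType KparG => (glob M : lmodType KG))
    (fun M N (f : {linear M -> N}) => (glob_map f : {linear glob M -> glob N}))
    glob_map_ext glob_map_id glob_map_comp glob_map_add.

End Globalization.

(* Main.v *)
Require Import Defs.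
From mathcomp Require Import all_boot all_algebra.

(** Preservation of surjectivity is formal: the tensors [g ⊗ p] additively
    generate [glob P], and each lifts along a surjection onto [P]. The content
    is the behaviour of kernels, and it comes from two opposite facts about
    tensors.

    For every [t : G] the rule [g ⊗ m |-> [t g] m] respects the defining
    relation of [glob M], hence gives an evaluation [glob_ev t : glob M -> M],
    natural in [M] ([glob_ev_map]). In particular evaluation at [g^-1] sends
    [g ⊗ m] back to [m].

    Conversely a tensor [g ⊗ m] can be split as
    [g0 ⊗ [g0^-1 g] m + g ⊗ (1 - e_h) m], where [h = g^-1 g0]
    ([gtens_split]), and the second summand is invisible to the evaluation at
    [g0^-1], because [[h^-1] (1 - e_h) = 0].

    So a sum of tensors [g0 ⊗ m0 + g1 ⊗ m1 + ... + gn ⊗ mn] can be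
    rewritten with the same group elements so that evaluation at [g0^-1]
    returns exactly the coefficient of [g0]. If such a sum is killed by
    [glob_map phi], naturality shows that [phi] kills this coefficient;
    discarding the term and proceeding by induction on the length shows that
    the kernel of [glob_map phi] is generated by the tensors [g ⊗ m] with
    [phi m = 0] ([glob_map_ker_ind]). Preservation of injectivity and exactness in
    the middle are both immediate from this description. *)

Set Implicit Arguments.
Unset Strict Implicit.
Unset Printing Implicit Defensive.

Import GRing.Theory.
Local Open Scope ring_scope.

Section PartialGroupAlgebra.
Variables (K : comPzRingType) (G : groupType).
Implicit Types s h : G.

Lemma gen_mulV h : gen K h * gen K h^-1%g * gen K h = gen K h.
Proof. by have := gen_mulVl K h^-1 h; rewrite invgK mulVg gen1 mulr1. Qed.

Lemma gen_mul_idem s h :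
  gen K (s * h)%g * idem K h^-1%g = gen K s * gen K h.
Proof. by rewrite /idem invgK mulrA -gen_mulVr -!mulrA [X in _ * X]mulrA gen_mulV. Qed.

Lemma genV_mul_idem h : gen K h^-1%g * idem K h = gen K h^-1%g.
Proof. by have := gen_mulV h^-1; rewrite invgK -mulrA. Qed.

End PartialGroupAlgebra.

Section Evaluation.
Variables (K : comPzRingType) (G : groupType) (M : lmodType (pargroupalg K G)).
Implicit Types (t g : G) (m : M).

Let shift t (a : groupalg K G) : pargroupalg K G :=
  freemod_lift (fun g => gen K (t * g)%g) a.

Fact glob_ev_bilinear t :
  bilinear_map (fun (a : groupalg K G) (m : resmod M) =>
    (shift t a *: (m : M) : resmod M)).
Proof.
split=> [m|a] c.
  move=> a b; rewrite /shift freemod_lift_linear scalerDl; congr (_ + _).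
  by rewrite [RHS]scalerA -monoidalg_scaleAl mul1r.
move=> m n; rewrite [LHS]scalerDr; congr (_ + _).
have -> : c *: m = (c *: (1 : pargroupalg K G)) *: (m : M) by [].
rewrite [LHS]scalerA -monoidalg_scaleAr mulr1.
by rewrite [RHS]scalerA -monoidalg_scaleAl mul1r.
Qed.

(** The two sides of the defining relation evaluate to [[t g h] e_(h^-1) m] and
    [[t g] [h] m], which agree by [gen_mul_idem]. *)
Fact glob_ev_subproof t x : glob_rel x -> tensor_lift (glob_ev_bilinear t) x = 0.
Proof.
case=> g h m; rewrite linearB /= !tensor_liftE /shift !freemod_lift_basis.
by rewrite [X in X - _]scalerA [X in _ - X]scalerA mulgA gen_mul_idem subrr.
Qed.

Definition glob_ev t (x : glob M) : M := quotmod_lift (glob_ev_subproof t) x.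

Lemma glob_evE t g m : glob_ev t (gtens (mon K g) m) = gen K (t * g)%g *: m.
Proof. by rewrite /glob_ev quotmod_liftE /= tensor_liftE /shift freemod_lift_basis. Qed.

Lemma glob_evD t x y : glob_ev t (x + y) = glob_ev t x + glob_ev t y.
Proof. exact: (linearD (quotmod_lift (glob_ev_subproof t))). Qed.

Lemma glob_ev0 t : glob_ev t 0 = 0.
Proof. exact: (linear0 (quotmod_lift (glob_ev_subproof t))). Qed.

End Evaluation.

Section Tensors.
Variables (K : comPzRingType) (G : groupType) (M : lmodType (pargroupalg K G)).
Implicit Types (g : G) (m : M).

Local Notation "g ⊗ m" := (gtens (mon K g) m) (at level 35).

Lemma gtensDr (a : groupalg K G) m n : gtens a (m + n) = gtens a m + gtens a n.
Proof. by rewrite /gtens tensDr linearD. Qed.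

Lemma gtens0r (a : groupalg K G) : gtens a (0 : M) = 0.
Proof. by apply: (addrI (gtens a (0 : M))); rewrite -gtensDr !addr0. Qed.

Lemma gtens_rel g h m : (g * h)%g ⊗ (idem K h^-1%g *: m) = g ⊗ (gen K h *: m).
Proof. exact/qclass_eq/span_gen/GlobRel. Qed.

Definition gsum (s : seq (G * M)) : glob M := \sum_(p <- s) p.1 ⊗ p.2.

Lemma gsum_nil : gsum [::] = 0.
Proof. exact: big_nil. Qed.

Lemma gsum_cons g m s : gsum ((g, m) :: s) = g ⊗ m + gsum s.
Proof. exact: big_cons. Qed.

Lemma gsum_surj (x : glob M) : exists s, x = gsum s.
Proof.
elim/glob_ind: x => [|a m _ [s ->]]; first by exists [::]; rewrite gsum_nil.
elim/monoidalg_ind: a s => [|c g a IH] s.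
  by exists s; rewrite /gtens tens0l linear0 add0r.
have [r ar] := IH s; exists ((g, (c *: (1 : pargroupalg K G)) *: m) :: r).
rewrite gtensDl -addrA ar gsum_cons; congr (_ + _).
by rewrite /gtens tensZl -tensZr.
Qed.

(** Multiplication by [e_h], [h = g^-1 g0], turns a tensor based at [g] into
    one based at [g0]; the complement [1 - e_h] cuts out what cannot be moved. *)
Lemma gtens_split g0 g m :
  g ⊗ m = g0 ⊗ (gen K (g0^-1 * g)%g *: m) + g ⊗ (m - idem K (g^-1 * g0)%g *: m).
Proof.
rewrite -gtens_rel mulgA mulgV mul1g invgM invgK -gtensDr.
by rewrite addrC subrK.
Qed.

Lemma glob_ev_rest g0 g m :
  glob_ev g0^-1%g (g ⊗ (m - idem K (g^-1 * g0)%g *: m)) = 0.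
Proof.
rewrite glob_evE scalerBr scalerA.
by have := genV_mul_idem K (g^-1 * g0); rewrite invgM invgK => ->; rewrite subrr.
Qed.

(** All terms of [s] are split against the single element [g0]; the collected
    remainder [r] has the same length, so that it can feed an induction. *)
Lemma gsum_split g0 (s : seq (G * M)) : exists m r,
  [/\ size r = size s, gsum s = g0 ⊗ m + gsum r
    & glob_ev g0^-1%g (gsum r) = 0].
Proof.
elim: s => [|[g m] s [n [r [sz_r sE r0]]]].
  by exists 0, [::]; rewrite gtens0r add0r gsum_nil glob_ev0.
exists (gen K (g0^-1 * g)%g *: m + n).
exists ((g, m - idem K (g^-1 * g0)%g *: m) :: r).
rewrite /= sz_r !gsum_cons sE glob_evD glob_ev_rest r0 addr0.
by split=> //; rewrite (gtens_split g0 g m) (gtensDr _ _ n) addrACA.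
Qed.

End Tensors.

Section Kernel.
Variables (K : comPzRingType) (G : groupType).
Variables (M N : lmodType (pargroupalg K G)) (phi : {linear M -> N}).

Lemma glob_ev_map (t : G) (x : glob M) :
  glob_ev t (glob_map phi x) = phi (glob_ev t x).
Proof.
have [s ->] := gsum_surj x.
elim: s => [|[g m] s IH]; first by rewrite gsum_nil glob_map0 !glob_ev0 linear0.
rewrite gsum_cons glob_mapD !glob_evD linearD IH; congr (_ + _).
by rewrite glob_mapE !glob_evE linearZ.
Qed.

(** The kernel of [glob_map phi] is additively generated by the [g ⊗ m] with
    [phi m = 0], put as an induction principle because this is how both
    injectivity and exactness in the middle consume it. Splitting the tail of a
    sum against its leading [g] leaves a coefficient of [g] that is the
    evaluation at [g^-1] of the whole sum, so [phi] kills it; the shorter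
    remainder is then again in the kernel. *)
Lemma glob_map_ker_ind (P : glob M -> Prop) :
  P 0 ->
  (forall g m x, phi m = 0 -> P x -> P (gtens (mon K g) m + x)) ->
  forall x, glob_map phi x = 0 -> P x.
Proof.
move=> P0 PD x; have [s ->] := gsum_surj x.
have [n] := ubnP (size s); elim: n s => // n IH [_ _|[g m] s /= lt_sn].
  by rewrite gsum_nil.
have [m' [r [sz_r sE r0]]] := gsum_split g s.
rewrite gsum_cons sE addrA -gtensDr.
set m1 := m + m'; move=> x0.
have m10 : phi m1 = 0.
  (* As [g^-1 g = 1], this evaluation returns the coefficient [m1]. *)
  have := glob_ev_map g^-1 (gtens (mon K g) m1 + gsum r).
  by rewrite x0 glob_ev0 glob_evD r0 glob_evE mulVg gen1 scale1r addr0 => <-.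
apply: PD => //; apply: IH; first by rewrite sz_r.
by move: x0; rewrite glob_mapD glob_mapE m10 gtens0r add0r.
Qed.

End Kernel.

Theorem theorem3p2 (K : comPzRingType) (G : groupType) :
  exact_functor (globalization K G).
Proof.
move=> M N P f g [f_inj fg_exact g_surj]; split=> /=.
- move=> x y /eqP; rewrite -subr_eq0 -linearB => /eqP xy.
  apply/eqP; rewrite -subr_eq0; apply/eqP.
  elim/(glob_map_ker_ind (phi := f)): (x - y) / xy => // h m z fm0 ->.
  by rewrite (f_inj m 0) ?linear0 // gtens0r addr0.
- move=> y; split=> [y0|[x <-]].
    elim/(glob_map_ker_ind (phi := g)): y / y0 => [|h n y gn0 [x <-]].
      by exists 0; rewrite linear0.
    have [m <-] := (fg_exact n).1 gn0.
    by exists (gtens (mon K h) m + x); rewrite glob_mapD glob_mapE.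
  elim/glob_ind: x => [|a m x IH]; first by rewrite !linear0.
  rewrite !linearD /= IH !glob_mapE.
  by rewrite (fg_exact (f m)).2 ?gtens0r ?addr0 //; exists m.
- elim/glob_ind=> [|a p _ [y <-]]; first by exists 0; rewrite linear0.
  have [n <-] := g_surj p.
  by exists (gtens a n + y); rewrite glob_mapD glob_mapE.
Qed.
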